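(* For each integer $r\geq 4$ and each $\varepsilon>0$ there is $t_0$ such that for every $t\geq t_0$ and every graph $F$ with minimum degree $t$, we have $$f_{F,K_r}(n)=\Omega\left(n^{\frac{1}{\lceil \log_2 r\rceil}-\varepsilon}\right)$$ as $n\to\infty$.
   Context: All graphs are finite and simple. A graph is $F$-free if it does not contain $F$ as a (not necessarily induced) subgraph. For graphs $F,H$ and a positive integer $n$, $f_{F,H}(n)$ denotes the largest $m$ such that every $H$-free graph on $n$ vertices contains an $F$-free induced subgraph on $m$ vertices. $K_r$ is the complete graph on $r$ vertices. The constant implied by $\Omega(\cdot)$ may depend on $r,\varepsilon,F$ but not on $n$. *)

(* Defs.v *)
From HB Require Import structures.
From mathcomp Require Import all_boot all_order all_algebra.
From mathcomp Require Import all_classical all_reals all_analysis.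
Set Implicit Arguments.
Unset Strict Implicit.
Unset Printing Implicit Defensive.
Import Order.TTheory GRing.Theory Num.Theory.
Import numFieldNormedType.Exports.

Record sgraph := SGraph {
  vertex :> finType;
  edge : rel vertex;
  edge_sym : symmetric edge;
  edge_irr : irreflexive edge }.

Definition contains (G F : sgraph) : Prop :=
  exists h : F -> G, injective h /\ forall x y : F, edge x y -> edge (h x) (h y).

Definition is_free (F G : sgraph) : Prop := ~ contains G F.

Section Induced.
Variables (G : sgraph) (S : {set G}).

Definition induced_edge : rel {x : G | x \in S} :=
  fun x y => edge (val x) (val y).

Lemma induced_sym : symmetric induced_edge.
Proof. by move=> x y; apply: edge_sym. Qed.

Lemma induced_irr : irreflexive induced_edge.
Proof. by move=> x; apply: edge_irr. Qed.

Definition induced : sgraph := SGraph induced_sym induced_irr.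

End Induced.

Section Complete.
Variable r : nat.

Definition complete_edge : rel 'I_r := fun x y => x != y.

Lemma complete_sym : symmetric complete_edge.
Proof. by move=> x y; rewrite /complete_edge eq_sym. Qed.

Lemma complete_irr : irreflexive complete_edge.
Proof. by move=> x; rewrite /complete_edge eqxx. Qed.

Definition complete_graph : sgraph := SGraph complete_sym complete_irr.

End Complete.

Definition degree (G : sgraph) (x : G) : nat := #|[set y | edge x y]|.

Definition has_min_degree (G : sgraph) (t : nat) : Prop :=
  (exists x : G, degree x = t) /\ (forall x : G, t <= degree x).

Definition guarantees_free_induced (F H : sgraph) (n m : nat) : Prop :=
  forall G : sgraph, #|G| = n -> is_free H G ->
    exists S : {set G}, #|S| = m /\ is_free F (induced S).

(* The bound m <= n loses nothing as soon as some H-free graph on n vertices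
   exists, which is the case for H = K_r with r >= 2.  The value m = 0 always
   qualifies when F has a vertex, so the maximum is then attained. *)
Definition erdos_rogers (F H : sgraph) (n : nat) : nat :=
  \max_(m < n.+1 | `[< guarantees_free_induced F H n m >]) m.

(* Main.v *)
(* Induction on k shows that a K_{2^k}-free graph on n vertices has an F-free
   set of order n^(1/k - eps).  Call an s-tuple big if it has at least
   D = n^(1 - 1/(k+1)) common neighbours.
   If there are many big s-tuples, dependent random choice gives a big tuple T
   such that every 2^k-tuple inside its common neighbourhood N(T) is big as well.
   Either N(T) is K_{2^k}-free, or it contains a K_{2^k} whose common
   neighbourhood must be K_{2^k}-free; both have order at least D, so the
   induction hypothesis applies.
   If there are few, keep each vertex with probability n^(-eps) / D and delete a
   vertex from every surviving big tuple and every surviving copy of F without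
   big tuples.  The latter are rare because a graph F of large minimum degree
   has a set A of at most delta |F| vertices such that every vertex has s
   neighbours in A: only the vertices of A are embedded freely, and each of the
   others has fewer than D choices. *)
Require Import Defs.
From HB Require Import structures.
From mathcomp Require Import all_boot all_order all_algebra.
From mathcomp Require Import all_classical all_reals all_analysis.
From mathcomp Require Import ring lra.
Import Order.TTheory GRing.Theory Num.Theory.
Import numFieldNormedType.Exports.
Set Implicit Arguments.
Unset Strict Implicit.
Unset Printing Implicit Defensive.
Local Open Scope ring_scope.

(** * Random vertex subsets and the alteration method *)

(** The probability of [f] when each vertex is kept independently with probability [p]; expectations
    become finite weighted sums. *)
Definition bernoulli_weight (R : realType) (V : finType) (p : R)
    (f : {set V}) : R :=
  \prod_v (if v \in f then p else 1 - p).

Lemma bernoulli_weight_ge0 (R : realType) (V : finType) (p : R)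
    (f : {set V}) : 0 <= p <= 1 -> 0 <= bernoulli_weight p f.
Proof.
move=> /andP[p0 p1]; apply: prodr_ge0 => v _.
by case: ifP => // _; rewrite subr_ge0.
Qed.

(** The indicator of [X \subset f] factors over the vertices: a vertex of [X] contributes [p], any
    other contributes [p + (1 - p) = 1]. *)
Lemma sum_bernoulli_weight_subset (R : realType) (V : finType) (p : R)
    (X : {set V}) :
  \sum_(f : {set V}) bernoulli_weight p f * (X \subset f)%:R = p ^+ #|X|.
Proof.
have prodE f : bernoulli_weight p f * (X \subset f)%:R =
    \prod_v ((if v \in f then p else 1 - p) * ((v \in X) ==> (v \in f))%:R).
  rewrite big_split /=; congr (_ * _).
  case: (boolP (X \subset f)) => [/fintype.subsetP Xf|/fintype.subsetPn[v vX vf]].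
    by rewrite big1 // => v _; case: (boolP (v \in X)) => //= /Xf ->.
  by rewrite (bigD1 v) //= vX (negbTE vf) /= mul0r.
under eq_bigr => f _ do rewrite prodE.
pose F b v : R := (if b then p else 1 - p) * ((v \in X) ==> b)%:R.
transitivity (\sum_(f : {set V}) \prod_v (if v \in f then F true v else F false v)).
  by apply: eq_bigr => f _; apply: eq_bigr => v _; rewrite /F; case: (v \in f).
rewrite -[LHS]bigA_distr -prodr_const [RHS]big_mkcond /=; apply: eq_bigr => v _.
rewrite /F; case: (v \in X) => /=; first by rewrite mulr1 mulr0 addr0.
by rewrite !mulr1; ring.
Qed.

(** Some [f] attains at least the mean of [#|U :&: f|] minus the number of sets [E i] inside [f].
    Deleting one vertex of each such [E i] costs at most that number. *)
Lemma alteration (R : realType) (V I : finType) (P : pred I) (E : I -> {set V})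
    (U : {set V}) (p : R) : 0 <= p <= 1 -> (forall i, P i -> E i != finset.set0) ->
  exists S : {set V}, [/\ S \subset U, forall i, P i -> ~~ (E i \subset S) &
    p * #|U|%:R - \sum_(i | P i) p ^+ #|E i| <= #|S|%:R].
Proof.
move=> p01 E0.
pose good (f : {set V}) : R :=
  \sum_(v in U) ([set v] \subset f)%:R - \sum_(i | P i) (E i \subset f)%:R.
pose target := p * #|U|%:R - \sum_(i | P i) p ^+ #|E i|.
have mean : \sum_(f : {set V}) bernoulli_weight p f * good f = target.
  rewrite /good; under eq_bigr => f _ do rewrite mulrBr !mulr_sumr.
  rewrite sumrB; congr (_ - _); rewrite exchange_big /=.
    under eq_bigr => v _ do rewrite sum_bernoulli_weight_subset cards1 expr1.
    by rewrite sumr_const mulr_natr.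
  by apply: eq_bigr => i _; rewrite sum_bernoulli_weight_subset.
have total : \sum_(f : {set V}) bernoulli_weight p f = 1.
  have := sum_bernoulli_weight_subset p (@finset.set0 V).
  rewrite cards0 expr0 => <-; apply: eq_bigr => f _.
  by rewrite finset.sub0set mulr1.
have [f fgood] : exists f : {set V}, target <= good f.
  (* If every [f] fell short, the nonnegative products of weight and deficit would sum to zero, so
     all weights would vanish, against total mass 1. *)
  case: (boolP [exists f : {set V}, target <= good f]) => [/existsP//|/existsPn bad].
  have lt (f : {set V}) : 0 <= bernoulli_weight p f * (target - good f).
    rewrite mulr_ge0 ?bernoulli_weight_ge0 // subr_ge0 ltW //.
    by rewrite ltNge bad.
  have eq0 : \sum_(f : {set V}) bernoulli_weight p f * (target - good f) = 0.
    under eq_bigr => f _ do rewrite mulrBr.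
    by rewrite sumrB -mulr_suml total mean mul1r subrr.
  have w0 (f : {set V}) : bernoulli_weight p f = 0.
    have /(_ f isT)/eqP := psumr_eq0P (fun f _ => lt f) eq0.
    by rewrite mulf_eq0 subr_eq0 orbC gt_eqF ?ltNge ?bad //= => /eqP.
  by move/eqP: total; rewrite big1 // eq_sym oner_eq0.
(* [pt i] is the vertex deleted on behalf of [i]; it is [None] only for an empty [E i], which [P i]
   excludes. *)
pose pt i : option V := [pick v in E i].
pose S := [set v in U | (v \in f) &
  ~~ [exists i, [&& P i, E i \subset f & pt i == Some v]]]%SET.
have ptP i : P i -> exists2 v, pt i = Some v & v \in E i.
  move=> /E0/finset.set0Pn[v vE]; rewrite /pt; case: pickP => [w wE|/(_ v)]; first by exists w.
  by rewrite vE.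
exists S; split.
- by apply/fintype.subsetP => v; rewrite !inE => /andP[].
- move=> i Pi; apply/negP => /fintype.subsetP ES.
  have [v piv /ES] := ptP i Pi; rewrite !inE => /and3P[_ _ /existsP[]].
  exists i; rewrite Pi piv eqxx andbT; apply/fintype.subsetP => w /ES.
  by rewrite !inE => /and3P[].
- apply: le_trans fgood _.
  pose J := [set i | P i & E i \subset f]%SET.
  rewrite /good -[X in _ - X]natr_sum -natr_sum lerBlDr -natrD ler_nat.
  have -> : (\sum_(v in U) ([set v] \subset f) = #|(U :&: f)%SET|)%N.
    rewrite -sum1_card [RHS]big_mkcond [LHS]big_mkcond; apply: eq_bigr => v _ /=.
    by rewrite !inE finset.sub1set; case: (v \in U) => //=; case: (v \in f).
  have -> : (\sum_(i | P i) (E i \subset f) = #|J|)%N.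
    rewrite -sum1_card [RHS]big_mkcond [LHS]big_mkcond; apply: eq_bigr => v _ /=.
    by rewrite !inE; case: (P v) => //=; case: (_ \subset _).
  pose im := [set pt i | i in J]%SET.
  have sub : (U :&: f)%SET \subset S :|: [set v | Some v \in im]%SET.
    apply/fintype.subsetP => v; rewrite !inE => /andP[-> ->] /=.
    case: existsP => //= -[i /and3P[Pi Ef /eqP piv]].
    by apply/imsetP; exists i; rewrite ?inE ?Pi.
  apply: leq_trans (subset_leq_card sub) _; apply: leq_trans (leq_card_setU _ _) _.
  rewrite leq_add2l; apply: leq_trans (leq_imset_card pt J).
  have Some_injective : injective (@Some V) by move=> ? ? [].
  rewrite -(card_imset _ Some_injective); apply: subset_leq_card.
  by apply/fintype.subsetP => _ /imsetP[v im_v ->]; rewrite inE in im_v.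
Qed.

(** * Sparse dominating sets in graphs of large minimum degree *)

(** Each vertex has [s] disjoint blocks of [L] neighbours. Alteration with density [p = 1 - q] gives
    a set containing no whole block; its complement [A] meets every block and has at most
    [(q + s * p ^ L) * #|F|] vertices. *)
Lemma exists_sparse_dominating (R : realType) (s : nat) (delta : R) : 0 < delta ->
  exists t0 : nat, forall F : sgraph, (forall x : F, t0 <= degree x)%N ->
    exists (A : {set F}) (T : F -> 'I_s -> F), #|A|%:R <= delta * #|F|%:R /\
      forall v, [/\ injective (T v), forall j, T v j \in A & forall j, edge v (T v j)].
Proof.
move=> d0; pose q : R := Num.min (delta / 2) 1; pose p := 1 - q.
have q0 : 0 < q by rewrite lt_min divr_gt0 // ltr01.
have q1 : q <= 1 by rewrite ge_min lexx orbT.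
have qd : q <= delta / 2 by rewrite ge_min lexx.
have p01 : 0 <= p <= 1 by rewrite /p subr_ge0 q1 lerBlDr lerDl ltW.
have [L L0 Lp] : exists2 L : nat, (0 < L)%N & s%:R * p ^+ L <= delta / 2.
  have : `|p| < 1 by rewrite ger0_norm /p; lra.
  (* Dividing by [s.+1] covers [s = 0]; the exponent [N.+1] keeps the blocks nonempty. *)
  move=> /cvg_expr/cvgrPdist_lt/(_ (delta / 2 / s.+1%:R)) [|N _ /(_ N.+1) /=].
    by rewrite !divr_gt0.
  rewrite sub0r normrN => /(_ (leqnSn N)) pN; exists N.+1 => //.
  apply: le_trans (_ : s.+1%:R * `|p ^+ N.+1| <= _).
    by apply: ler_pM; rewrite ?ler0n ?exprn_ge0 ?ler_nat ?ler_norm //; case/andP: p01.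
  by rewrite mulrC -ler_pdivlMr ?ltW // ltr0n.
exists (s * L)%N => F degF.
pose nb (v : F) := enum [set y | edge v y]%SET.
(* Block [j] of [v] holds the neighbours at positions [j * L] to [j * L + L - 1] of [nb v]. Blocks
   of one vertex are disjoint, which makes [T v] injective below. *)
pose B (i : F * 'I_s) := [set x | edge i.1 x && (index x (nb i.1) %/ L == i.2)]%N%SET.
have cardB i : (L <= #|B i|)%N.
  case: i => v j.
  have lt_size (i : 'I_L) : (j * L + i < size (nb v))%N.
    rewrite -cardE; apply: leq_trans (degF v).
    apply: leq_trans (_ : j.+1 * L <= _)%N; last by rewrite leq_mul2r ltn_ord orbT.
    by rewrite mulSn addnC ltn_add2r.
  pose g (i : 'I_L) := nth v (nb v) (j * L + i).
  have g_inj : injective g.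
    move=> i i' /eqP; rewrite nth_uniq ?lt_size ?enum_uniq // eqn_add2l => /eqP.
    exact: val_inj.
  rewrite -{1}(card_ord L) -(card_imset _ g_inj); apply: subset_leq_card.
  apply/fintype.subsetP => _ /imsetP[i _ ->]; rewrite inE /=.
  have := mem_nth v (lt_size i); rewrite mem_enum inE => -> /=.
  by rewrite index_uniq ?lt_size ?enum_uniq // divnMDl // divn_small ?addn0.
(* The complement of the altered set S meets every block B (v, j). *)
have [|S [_ BS cardS]] := alteration (P := predT) (E := B) [set: F]%SET p01.
  by move=> i _; rewrite -card_gt0 (leq_trans L0).
have hit v j : exists x, (x \in ~: S) && (x \in B (v, j)).
  have /fintype.subsetPn[x xB xS] := BS (v, j) isT.
  by exists x; rewrite xB inE xS.
pose T v j := xchoose (hit v j); exists (~: S)%SET, T; split.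
  have : \sum_(i : F * 'I_s) p ^+ #|B i| <= (#|F| * s)%:R * p ^+ L.
    rewrite -[X in (_ * X)%N](card_ord s) -card_prod mulr_natl -sumr_const.
    by apply: ler_sum => i _; apply: ler_wiXn2l => //; case/andP: p01.
  have : (#|F|%:R : R) = #|S|%:R + #|~: S|%:R by rewrite -natrD cardsC.
  have : #|F|%:R * (q + s%:R * p ^+ L) <= #|F|%:R * delta.
    by apply: ler_wpM2l; rewrite ?ler0n //; lra.
  move: cardS; rewrite cardsT natrM mulrDr mulrA /p; lra.
move=> v; have TB j : T v j \in ~: S /\ T v j \in B (v, j).
  exact/andP/(xchooseP (hit v j)).
split=> [j j' TT|j|j].
- have [_] := TB j; have [_] := TB j'; rewrite TT !inE => /andP[_ /eqP ej'] /andP[_ /eqP ej].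
  exact/val_inj/(etrans (esym ej) ej').
- by have [] := TB j.
- by have [_] := TB j; rewrite inE => /andP[].
Qed.

(** * Common neighbourhoods and dependent random choice *)

Definition common_nbrs (G : sgraph) (U : {set G}) (I : finType) (T : I -> G) : {set G} :=
  [set x in U | [forall i, edge (T i) x]]%SET.

(** Such an [h] is injective because [edge] is irreflexive. *)
Definition has_clique (G : sgraph) (U : {set G}) (m : nat) : Prop :=
  exists h : 'I_m -> G, (forall i, h i \in U) /\ forall i j, i != j -> edge (h i) (h j).

(** Stated inside [G] rather than in [induced S], so that the induction can pass to subsets without
    changing the graph. *)
Definition free_on (F G : sgraph) (S : {set G}) : Prop :=
  ~ exists h : F -> G, [/\ injective h, forall x, h x \in S &
      forall x y, edge x y -> edge (h x) (h y)].

Lemma common_nbrs_sub (G : sgraph) (U : {set G}) (I : finType) (T : I -> G) :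
  common_nbrs U T \subset U.
Proof. by apply/fintype.subsetP => x; rewrite inE => /andP[]. Qed.

Lemma common_nbrsP (G : sgraph) (U : {set G}) (I : finType) (T : I -> G) x :
  reflect (x \in U /\ forall i, edge (T i) x) (x \in common_nbrs U T).
Proof. by rewrite inE; apply: (iffP andP) => -[xU /forallP]. Qed.

Lemma eq_common_nbrs (G : sgraph) (U : {set G}) (I : finType) (T T' : I -> G) :
  T =1 T' -> common_nbrs U T = common_nbrs U T'.
Proof.
move=> TT'; apply/setP => x; rewrite !inE; congr (_ && _).
by apply: eq_forallb => i; rewrite TT'.
Qed.

(** Tuples are ordered and may repeat entries; injectivity is imposed only when their images are to
    be destroyed. *)
Definition big_tuples (R : realType) (G : sgraph) (U : {set G}) (D : R) (s : nat) :=
  [set T : {ffun 'I_s -> G} | (T \in ffun_on (mem U)) &&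
    (D <= #|common_nbrs U T|%:R)]%SET.

(* Double counting pairs (T, X), with T a big tuple and X a tuple in its common
   neighbourhood that is not itself big. *)
Lemma dependent_choice_tuple (R : realType) (G : sgraph) (U : {set G}) (D : R)
    (s m : nat) : 0 <= D -> #|U|%:R ^+ m * D ^+ s < #|big_tuples U D s|%:R ->
  exists2 T : 'I_s -> G, D <= #|common_nbrs U T|%:R &
    forall X : 'I_m -> G, (forall i, X i \in common_nbrs U T) ->
      D <= #|common_nbrs U X|%:R.
Proof.
move=> D0 many; apply: contrapT => none.
pose poor := [set X : {ffun 'I_m -> G} | (X \in ffun_on (mem U)) &&
  (#|common_nbrs U X|%:R < D)]%SET.
(* By symmetry of [edge], [X] lies in the common neighbourhood of [T] only if [T] lies in that of
   [X]. So each poor [X] accounts for at most [D ^+ s] big tuples. *)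
have ex (T : {ffun 'I_s -> G}) : T \in big_tuples U D s ->
    exists2 X, X \in poor & T \in ffun_on (mem (common_nbrs U X)).
  rewrite inE => /andP[/ffun_onP TU bigT]; apply: contrapT => noX; apply: none.
  exists T => // X XT; rewrite leNgt; apply/negP => poorX; apply: noX.
  have XE : common_nbrs U (finfun X) = common_nbrs U X.
    by apply: eq_common_nbrs => i; rewrite ffunE.
  exists (finfun X).
    rewrite inE XE poorX andbT; apply/ffun_onP => i; rewrite ffunE.
    by have /common_nbrsP[] := XT i.
  apply/ffun_onP => j; rewrite XE; apply/common_nbrsP; split; first exact: TU.
  by move=> i; rewrite edge_sym; have /common_nbrsP[_] := XT i.
suff : #|big_tuples U D s|%:R <= #|U|%:R ^+ m * D ^+ s by rewrite leNgt many.
have : (#|big_tuples U D s| <= \sum_(X in poor) #|common_nbrs U X| ^ s)%N.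
  rewrite -sum1_card.
  apply: leq_trans (_ : \sum_(T in big_tuples U D s)
     \sum_(X in poor) (T \in ffun_on (mem (common_nbrs U X))) <= _)%N.
    apply: leq_sum => T /ex[X Xpoor TX].
    by rewrite (bigD1 X) //= TX.
  rewrite exchange_big /=; apply: leq_sum => X _.
  have -> : (#|common_nbrs U X| ^ s)%N =
      #|(ffun_on (mem (common_nbrs U X)) : {pred {ffun 'I_s -> G}})|.
    by rewrite card_ffun_on card_ord.
  rewrite -sum1_card [X in (_ <= X)%N]big_mkcond.
  rewrite [X in (X <= _)%N]big_mkcond; apply: leq_sum => T _.
  by case: (_ \in big_tuples _ _ _); case: (_ \in ffun_on _).
rewrite -(ler_nat R) => /le_trans; apply; rewrite natr_sum.
apply: le_trans (_ : \sum_(X in poor) D ^+ s <= _).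
  apply: ler_sum => X; rewrite inE natrX => /andP[_ /ltW XD].
  by rewrite lerXn2r ?nnegrE ?ler0n.
rewrite sumr_const -[X in X <= _]mulr_natl ler_wpM2r ?exprn_ge0 //.
rewrite -natrX ler_nat.
have -> : (#|U| ^ m)%N = #|(ffun_on (mem U) : {pred {ffun 'I_m -> G}})|.
  by rewrite card_ffun_on card_ord.
by apply: subset_leq_card; apply/fintype.subsetP => f; rewrite inE => /andP[].
Qed.

(** * Copies of [F] without big tuples, and the random sample *)

(** The values on [A] are chosen freely in [U]. They determine every [h \o T v], hence leave at most
    [D] candidates for each vertex outside [A]. *)
Lemma card_light_embeddings (R : realType) (F G : sgraph) (U : {set G}) (D : R)
    (s : nat) (A : {set F}) (T : F -> 'I_s -> F) (x0 : F) :
  0 <= D -> (forall v j, T v j \in A) ->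
  #|[set h : {ffun F -> G} | (h \in ffun_on (mem U)) &&
      [forall v, (h v \in common_nbrs U (h \o T v)) &&
        (#|common_nbrs U (h \o T v)|%:R < D)]]%SET|%:R
    <= #|U|%:R ^+ #|A| * D ^+ (#|F| - #|A|).
Proof.
move=> D0 TA; set H := finset _.
have [->|[h0 _]] := finset.set_0Vmem H.
  by rewrite cards0 mulr_ge0 ?exprn_ge0.
(* The filler value outside [A] for restricted maps; [G] is known to have a vertex only because [H]
   is nonempty here. *)
pose y0 := h0 x0.
(* [C g v] is the set of candidates for [h v] once [h] agrees with [g] on [A]. *)
pose C (g : {ffun F -> G}) (v : F) : {set G} :=
  if v \in A then [set g v]%SET else
  if #|common_nbrs U (g \o T v)|%:R < D then common_nbrs U (g \o T v) else finset.set0.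
have restrict h : h \in H ->
    exists2 g, g \in pffun_on y0 (mem A) (mem U) & h \in family (fun v => mem (C g v)).
  rewrite inE => /andP[/ffun_onP hU /forallP hT].
  pose g : {ffun F -> G} := [ffun v => if v \in A then h v else y0].
  have gT v : g \o T v =1 h \o T v by move=> j; rewrite /= ffunE TA.
  exists g.
    apply/pffun_onP; split; last by move=> y /fintype.imageP[v vA ->]; rewrite ffunE vA hU.
    by apply/supportP => v vA; rewrite ffunE (negbTE vA).
  apply/familyP => v; rewrite /C (eq_common_nbrs _ (gT v)).
  have /andP[hv ->] := hT v; case: ifP => // vA.
  by rewrite !inE ffunE vA.
have : (#|H| <= \sum_(g in pffun_on y0 (mem A) (mem U)) \prod_v #|C g v|)%N.
  rewrite -sum1_card.
  apply: leq_trans (_ : \sum_(h in H)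
     \sum_(g in pffun_on y0 (mem A) (mem U)) (h \in family (fun v => mem (C g v))) <= _)%N.
    apply: leq_sum => h /restrict[g gA hg].
    by rewrite (bigD1 g) //= hg.
  rewrite exchange_big /=; apply: leq_sum => g _.
  have -> : (\prod_v #|C g v| = #|family (fun v => mem (C g v))|)%N.
    by rewrite card_family foldrE big_map big_enum.
  rewrite -sum1_card [X in (_ <= X)%N]big_mkcond.
  rewrite [X in (X <= _)%N]big_mkcond; apply: leq_sum => h _.
  by case: (_ \in H); case: (_ \in family _).
rewrite -(ler_nat R) => /le_trans; apply; rewrite natr_sum.
apply: le_trans (_ : \sum_(g in pffun_on y0 (mem A) (mem U)) D ^+ (#|F| - #|A|) <= _).
  apply: ler_sum => g _; rewrite natr_prod.
  have -> : D ^+ (#|F| - #|A|) = \prod_v (if v \in A then 1 else D).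
    rewrite -(cardsC A) addKn -prodr_const big_mkcond /=; apply: eq_bigr => v _.
    by rewrite inE; case: (v \in A).
  apply: ler_prod => v _; rewrite ler0n /= /C.
  case: ifP => _; first by rewrite cards1.
  by case: ifP => [/ltW //|_]; rewrite cards0.
by rewrite sumr_const card_pffun_on -[X in X <= _]mulr_natl natrX.
Qed.

(** Alteration is applied to the images of injective big tuples and of injective light maps. A copy
    [h] of [F] in [S] would contain an image of the first kind if some [h \o T v] is big, and be one
    of the second kind otherwise. Injectivity gives the images exactly [s] and [#|F|] elements. *)
Lemma exists_free_sample (R : realType) (F G : sgraph) (U : {set G}) (p D : R)
    (s : nat) (A : {set F}) (T : F -> 'I_s -> F) (x0 : F) :
  0 <= p <= 1 -> 0 <= D -> (0 < s)%N ->
  (forall v, [/\ injective (T v), forall j, T v j \in A & forall j, edge v (T v j)]) ->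
  exists S : {set G}, [/\ S \subset U, free_on F S &
    p * #|U|%:R - p ^+ s * #|big_tuples U D s|%:R
      - p ^+ #|F| * (#|U|%:R ^+ #|A| * D ^+ (#|F| - #|A|)) <= #|S|%:R].
Proof.
move=> p01 D0 s0 TA.
set bound := #|U|%:R ^+ #|A| * _.
set H := [set h : {ffun F -> G} | (h \in ffun_on (mem U)) &&
      [forall v, (h v \in common_nbrs U (h \o T v)) &&
        (#|common_nbrs U (h \o T v)|%:R < D)]]%SET.
have cardH : #|H|%:R <= bound.
  by apply: card_light_embeddings => // v j; have [] := TA v.
pose P (i : {ffun 'I_s -> G} + {ffun F -> G}) : bool :=
  match i with
  | inl Q => (Q \in big_tuples U D s) && injectiveb Q
  | inr h => (h \in H) && injectiveb h
  end.
pose E (i : {ffun 'I_s -> G} + {ffun F -> G}) : {set G} :=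
  match i with
  | inl Q => [set Q j | j : 'I_s]%SET
  | inr h => [set h v | v : F]%SET
  end.
have [|S [SU SE cardS]] := alteration (P := P) (E := E) U p01.
  case=> [Q|h] _; apply/finset.set0Pn.
    by exists (Q (Ordinal s0)); apply: imset_f.
  by exists (h x0); apply: imset_f.
exists S; split=> //.
  move=> [h [h_inj hS h_edge]].
  have small v : #|common_nbrs U (h \o T v)|%:R < D.
    have [T_inj TvA Tv_edge] := TA v; rewrite ltNge; apply/negP => bigT.
    have := SE (inl (finfun (h \o T v))); rewrite /P /E => /(_ _)/negP; apply.
      apply/andP; split.
        rewrite inE; apply/andP; split.
          by apply/ffun_onP => j; rewrite ffunE; apply: (fintype.subsetP SU); apply: hS.
        by rewrite (eq_common_nbrs U (ffunE (h \o T v))).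
      by apply/injectiveP => j j'; rewrite !ffunE => /h_inj/T_inj.
    by apply/fintype.subsetP => _ /imsetP[j _ ->]; rewrite ffunE /=.
  have := SE (inr (finfun h)); rewrite /P /E => /(_ _)/negP; apply; last first.
    by apply/fintype.subsetP => _ /imsetP[j _ ->]; rewrite ffunE.
  apply/andP; split; last by apply/injectiveP => j j'; rewrite !ffunE => /h_inj.
  rewrite inE; apply/andP; split.
    by apply/ffun_onP => j; rewrite ffunE; apply: (fintype.subsetP SU); apply: hS.
  apply/forallP => v.
  have [T_inj TvA Tv_edge] := TA v.
  have -> : common_nbrs U (finfun h \o T v) = common_nbrs U (h \o T v).
    by apply: eq_common_nbrs => j; rewrite /= ffunE.
  rewrite small andbT ffunE; apply/common_nbrsP; split.
    by apply: (fintype.subsetP SU); apply: hS.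
  by move=> j /=; rewrite edge_sym h_edge.
apply: le_trans cardS; rewrite -addrA -opprD lerB //.
have [p0 p1] := andP p01.
rewrite big_sumType /= lerD //.
  apply: le_trans (_ : \sum_(Q in big_tuples U D s) p ^+ s <= _).
    rewrite big_mkcondr /=; apply: ler_sum => Q _; case: ifP => [/injectiveP Q_inj|_].
      by rewrite card_imset // card_ord.
    exact: exprn_ge0.
  by rewrite sumr_const mulr_natr.
apply: le_trans (_ : \sum_(h in H) p ^+ #|F| <= _).
  rewrite big_mkcondr /=; apply: ler_sum => h _; case: ifP => [/injectiveP h_inj|_].
    by rewrite card_imset.
  exact: exprn_ge0.
by rewrite sumr_const -[X in X <= _]mulr_natr ler_wpM2l ?exprn_ge0.
Qed.

(** * Large [F]-free sets in graphs without a clique of order [2 ^ k.+1] *)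

Lemma has_clique_cat (G : sgraph) (U : {set G}) (m m' : nat) (h : 'I_m -> G) :
  (forall i, h i \in U) -> (forall i j, i != j -> edge (h i) (h j)) ->
  has_clique (common_nbrs U h) m' -> has_clique U (m + m').
Proof.
move=> hU h_edge [h' [h'N h'_edge]].
exists (fun i => match fintype.split i with inl a => h a | inr b => h' b end); split.
  by move=> i; case: fintype.split => [a|b]; rewrite ?hU //; have /common_nbrsP[] := h'N b.
have cross a b : edge (h a) (h' b) by have /common_nbrsP[_] := h'N b.
move=> i j; rewrite -[i]splitK -[j]splitK !unsplitK.
case: (fintype.split i) (fintype.split j) => [a|b] [a'|b'] ij //=.
- by apply: h_edge; apply: contraNneq ij => ->.
- by rewrite edge_sym.
- by apply: h'_edge; apply: contraNneq ij => ->.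
Qed.

Lemma free_on_set1 (F G : sgraph) (x : F) (v : G) :
  (0 < degree x)%N -> free_on F [set v]%SET.
Proof.
rewrite card_gt0 => /finset.set0Pn[y]; rewrite inE => xy [h [_ hv h_edge]].
have := h_edge _ _ xy; have := hv x; have := hv y; rewrite !inE => /eqP -> /eqP ->.
by rewrite edge_irr.
Qed.

Lemma powR_expr (R : realType) (a x : R) (m : nat) : (a `^ x) ^+ m = a `^ (x * m%:R).
Proof. by rewrite -powR_mulrn ?powR_ge0 // -powRrM. Qed.

Lemma powR_addr (R : realType) (a x y : R) : 0 < a -> a `^ x * a `^ y = a `^ (x + y).
Proof. by move=> a0; rewrite powRD // (gt_eqF a0) implybT. Qed.

(** Induction on [k], shifted by one so that it starts with edgeless sets. Subsets [U] of an
    arbitrary [G] let the hypothesis apply to common neighbourhoods. *)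
Lemma exists_large_free_on (R : realType) (k : nat) (eps : R) : 0 < eps ->
  exists t0 : nat, forall (F : sgraph) (x0 : F), (forall x : F, t0 <= degree x)%N ->
    exists2 C : R, 0 < C & forall (G : sgraph) (U : {set G}), (0 < #|U|)%N ->
      ~ has_clique U (2 ^ k.+1) ->
      exists S : {set G}, [/\ S \subset U, free_on F S &
        C * #|U|%:R `^ (k.+1%:R^-1 - eps) <= #|S|%:R].
Proof.
move=> eps0; elim: k => [|k [t1 IH]].
  exists 1%N => F x0 degF; exists 1 => // G U U0 noK2; exists U; split=> //.
    move=> [h [_ hU h_edge]]; apply: noK2.
    have := degF x0; rewrite card_gt0 => /finset.set0Pn[y]; rewrite inE => xy.
    exists (fun i : 'I_2 => if i == ord0 then h x0 else h y); split=> [i|i j].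
      by case: ifP.
    by case: i j => -[|[|//]] ? [[|[|//]] ?] //= _; rewrite ?[edge (h y) _]edge_sym h_edge.
  rewrite mul1r invr1 -[leRHS]powRr1 ?ler0n // ler_powR ?ler1n //.
  by rewrite lerBlDr lerDl ltW.
pose r0 := (2 ^ k.+1)%N; pose c : R := k.+2%:R^-1.
have c0 : 0 < c by rewrite invr_gt0 ltr0n.
have c1 : c < 1 by rewrite invf_lt1 ?ltr1n ?ltr0n.
(* Chosen so that the expected number of surviving big tuples, at most [n ^ (r0 - eps * s)], is at
   most 1. *)
have [s s0 s_large] : exists2 s : nat, (0 < s)%N & r0%:R <= eps * s%:R.
  exists (Num.truncn (r0%:R / eps)).+1 => //.
  by rewrite mulrC -ler_pdivrMr // ltW // truncnS_gt.
(* With [delta = eps / c], the expected number of surviving light copies, at most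
   [n ^ (c * #|A| - eps * #|F|)], is at most 1. *)
have [t2 dom] := exists_sparse_dominating s (divr_gt0 eps0 c0).
exists (maxn 1 (maxn t1 t2)) => F x0 degF.
have deg1 x : (0 < degree (x : F))%N by apply: leq_trans (degF x); apply: leq_maxl.
have deg_t1 x : (t1 <= degree (x : F))%N.
  by apply: leq_trans (degF x); rewrite !leq_max leqnn orbT.
have deg_t2 x : (t2 <= degree (x : F))%N.
  by apply: leq_trans (degF x); rewrite !leq_max leqnn !orbT.
have [C' C'0 HC'] := IH F x0 deg_t1.
have [A [T [cardA TA]]] := dom F deg_t2.
(* The factor 1/4 serves both ranges of [y]: below 4 a single vertex suffices, and from 4 on
   [y - 2 >= y / 4] absorbs the two losses of 1. *)
exists (Num.min C' 4^-1) => [|G U U0 noK]; first by rewrite lt_min C'0 invr_gt0 ltr0n.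
set n : R := #|U|%:R; have n1 : 1 <= n by rewrite ler1n.
have n0 : 0 < n by apply: lt_le_trans n1.
set y := n `^ (c - eps).
have y0 : 0 <= y by apply: powR_ge0.
have [y4|y4] := ltP y 4.
  have [v vU] := card_gt0P U0; exists [set v]%SET; split.
  - by rewrite finset.sub1set.
  - exact: (free_on_set1 (deg1 x0)).
  rewrite cards1; apply: le_trans (_ : 4^-1 * y <= _); last lra.
  by apply: ler_wpM2r => //; rewrite ge_min lexx orbT.
have eps_c : eps < c.
  rewrite ltNge; apply/negP => c_eps.
  have : y <= n `^ 0 by apply: ler_powR => //; lra.
  by rewrite powRr0; lra.
pose D := n `^ (1 - c); have D0 : 0 <= D by apply: powR_ge0.
have Dgt0 : 0 < D by apply: powR_gt0.
have useIH (W : {set G}) : W \subset U -> D <= #|W|%:R -> ~ has_clique W r0 ->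
    exists S : {set G}, [/\ S \subset U, free_on F S & Num.min C' 4^-1 * y <= #|S|%:R].
  move=> WU DW noW; have W0 : (0 < #|W|)%N by rewrite -(ltr0n R) (lt_le_trans Dgt0).
  have [S [SW freeS cardS]] := HC' G W W0 noW; exists S; split=> //.
    exact: fintype.subset_trans SW WU.
  apply: le_trans cardS; apply: ler_pM => //.
  - by rewrite le_min ltW //= invr_ge0.
  - by rewrite ge_min lexx.
  have ck : c * (k.+1%:R + 1) = 1 by rewrite natr1 mulVf // pnatr_eq0.
  have kk : k.+1%:R * k.+1%:R^-1 = 1 :> R by rewrite mulfV // pnatr_eq0.
  (* Hence the induction hypothesis on [D] vertices yields exponent [c - (1 - c) * eps], which is at
     least [c - eps]. *)
  have ckE : (1 - c) * k.+1%:R^-1 = c.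
    have -> : 1 - c = c * k.+1%:R by rewrite -[X in X - c]ck mulrDr mulr1 addrK.
    by rewrite -mulrA kk mulr1.
  have ge0 : 0 <= k.+1%:R^-1 - eps.
    rewrite subr_ge0 (le_trans (ltW eps_c)) // -[leLHS]ckE.
    by rewrite ler_piMl ?invr_ge0 ?ler0n // gerBl ltW.
  apply: le_trans (_ : D `^ (k.+1%:R^-1 - eps) <= _).
    by rewrite -powRrM mulrBr ckE; apply: ler_powR => //; have := mulr_gt0 c0 eps0; lra.
  by apply: ge0_ler_powR; rewrite ?nnegrE.
have [many|few] := ltP (n ^+ r0 * D ^+ s) #|big_tuples U D s|%:R.
  have [Q DQ QX] := dependent_choice_tuple D0 many.
  have [[h [hQ h_edge]]|noQ] := pselect (has_clique (common_nbrs U Q) r0); last first.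
    by apply: useIH noQ => //; apply: common_nbrs_sub.
  apply: (useIH (common_nbrs U h)) => //; [exact: common_nbrs_sub|exact: QX|].
  move=> /has_clique_cat K; apply: noK; rewrite expnS mul2n -addnn; apply: K => // i.
  by have /common_nbrsP[] := hQ i.
(* Here [p * n = y] and [p * D = n ^ (- eps)]. *)
pose p := n `^ (c - 1 - eps).
have p01 : 0 <= p <= 1.
  by rewrite powR_ge0 /= -[leRHS](powRr0 n) ler_powR //; lra.
have [S [SU freeS cardS]] := exists_free_sample U x0 p01 D0 s0 TA.
exists S; split=> //.
apply: le_trans cardS; rewrite -/n.
have pnE : p * n = y.
  by rewrite -[X in _ * X](powRr1 (ltW n0)) powR_addr //; congr (_ `^ _); lra.
have tuples1 : p ^+ s * #|big_tuples U D s|%:R <= 1.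
  apply: le_trans (_ : p ^+ s * (n ^+ r0 * D ^+ s) <= _).
    by apply: ler_wpM2l; rewrite ?exprn_ge0 ?powR_ge0.
  rewrite -(powR_mulrn _ (ltW n0)) !powR_expr !powR_addr // -[leRHS](powRr0 n) ler_powR //.
  have -> : (c - 1 - eps) * s%:R + (r0%:R + (1 - c) * s%:R) = r0%:R - eps * s%:R by ring.
  by rewrite subr_le0.
have copies1 : p ^+ #|F| * (n ^+ #|A| * D ^+ (#|F| - #|A|)) <= 1.
  rewrite -(powR_mulrn _ (ltW n0)) !powR_expr !powR_addr // -[leRHS](powRr0 n) ler_powR //.
  rewrite natrB ?max_card //.
  have : c * #|A|%:R <= eps * #|F|%:R.
    by rewrite mulrC -ler_pdivlMr // mulrAC.
  set a := #|A|%:R; set f := #|F|%:R => ca.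
  have -> : (c - 1 - eps) * f + (a + (1 - c) * (f - a)) = c * a - eps * f by ring.
  by rewrite subr_le0.
rewrite pnE; apply: le_trans (_ : 4^-1 * y <= _); last lra.
by apply: ler_wpM2r => //; rewrite ge_min lexx orbT.
Qed.

(** * From free sets to the Erdos-Rogers function *)

Lemma erdos_rogers_ge (F H : sgraph) (n m : nat) :
  (m <= n)%N -> guarantees_free_induced F H n m -> (m <= erdos_rogers F H n)%N.
Proof.
move=> mn guar; rewrite /erdos_rogers.
by rewrite (bigD1 (Ordinal (mn : (m < n.+1)%N))) ?leq_maxl //=; apply/asboolP.
Qed.

Lemma is_free_complete_no_clique (G : sgraph) (r m : nat) :
  (r <= m)%N -> is_free (complete_graph r) G -> ~ has_clique [set: G]%SET m.
Proof.
move=> rm free_r [h [_ h_edge]]; apply: free_r.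
exists (fun i : 'I_r => h (widen_ord rm i)); split=> [i j hij|i j ij]; last first.
  by apply: h_edge; apply: contraNneq ij => -[/val_inj ->].
apply/eqP; apply: contraT => ij.
have : edge (h (widen_ord rm i)) (h (widen_ord rm j)).
  by apply: h_edge; apply: contraNneq ij => -[/val_inj ->].
by rewrite hij edge_irr.
Qed.

Lemma free_on_induced (F G : sgraph) (S S' : {set G}) :
  S' \subset S -> free_on F S -> is_free F (Defs.induced S').
Proof.
move=> S'sub freeS [h [h_inj h_edge]]; apply: freeS.
exists (fun x => val (h x)); split=> [x y /val_inj/h_inj //|x|x y /h_edge //].
exact: (fintype.subsetP S'sub _ (valP (h x))).
Qed.

Lemma exists_subset_card (T : finType) (S : {set T}) (m : nat) :
  (m <= #|S|)%N -> exists2 S' : {set T}, S' \subset S & #|S'| = m.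
Proof.
move=> mS; exists [set x in take m (enum S)]%SET.
  by apply/fintype.subsetP => x; rewrite inE => /mem_take; rewrite mem_enum.
rewrite cardsE (card_uniqP _) ?take_uniq ?enum_uniq // size_take -cardE.
by case: ltngtP mS.
Qed.

(** The guarantee asks for exactly [m] vertices, so a larger free set is trimmed. [M] will be the
    power of two that the induction handles. *)
Lemma guarantees_free_induced_complete (F : sgraph) (r n m M : nat) :
  (r <= M)%N -> (forall G : sgraph, #|G| = n -> ~ has_clique [set: G]%SET M ->
    exists2 S : {set G}, free_on F S & (m <= #|S|)%N) ->
  guarantees_free_induced F (complete_graph r) n m.
Proof.
move=> rM free_set G Gn /(is_free_complete_no_clique rM)/(free_set G Gn)[S freeS mS].
have [S' S'S cardS'] := exists_subset_card mS.
by exists S'; split=> //; apply: free_on_induced freeS.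
Qed.

(** Writing the ceiling as a successor matches the shifted index of the induction and rounds [r] up
    to a power of two. *)
Lemma ceil_log2 (R : realType) (r : nat) : (2 <= r)%N ->
  exists2 k : nat, Num.ceil (ln r%:R / ln 2 : R) = k.+1%:Z & (r <= 2 ^ k.+1)%N.
Proof.
move=> r2; have ln2 : 0 < ln 2 :> R by rewrite ln_gt0 // ltr1n.
have r0 : (0 < r)%N by apply: leq_trans r2.
set x := ln _ / _.
have x0 : 0 < x by rewrite divr_gt0 // ln_gt0 // ltr1n.
have := ceil_ge x; have : 0 < Num.ceil x by rewrite ceil_gt0.
case: (Num.ceil x) => // -[//|k] _ xk; exists k => //.
rewrite -(ler_nat R) natrX -ler_ln ?posrE ?exprn_gt0 ?ltr0n // lnXn //.
by rewrite -[leRHS]mulr_natl -ler_pdivrMr.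
Qed.

Local Open Scope classical_set_scope.
Local Open Scope ring_scope.

Theorem theorem1p7 (R : realType) (r : nat) (hr : (4 <= r)%N)
    (eps : R) (heps : 0 < eps) :
  exists t0 : nat, forall t : nat, (t0 <= t)%N ->
    forall F : sgraph, has_min_degree F t ->
      (fun n : nat => (erdos_rogers F (complete_graph r) n)%:R : R^o) \is
      'Omega_\oo (fun n : nat =>
        n%:R `^ (1 / (Num.ceil (ln r%:R / ln 2 : R))%:~R - eps) : R^o).
Proof.
have [k -> rk] := @ceil_log2 R r (leq_trans (isT : 2 <= 4)%N hr).
have [t0 large] := exists_large_free_on k heps.
exists t0 => t t0t F [[x0 _] degF].
have [C C0 HC] := large F x0 (fun x => leq_trans t0t (degF x)).
(* The minimum with 1 keeps the bound at most [n], as the range of the maximum in [erdos_rogers]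
   demands. *)
rewrite qualifE; apply/asboolP; exists (Num.min C 1); first by rewrite lt_min C0 ltr01.
exists 1%N => // n /= n0.
have n1 : 1 <= n%:R :> R by rewrite ler1n.
rewrite div1r -pmulrn !ger0_norm ?powR_ge0 //.
set y := n%:R `^ _; set x := Num.min C 1 * y.
have y0 : 0 <= y by apply: powR_ge0.
have x0' : 0 <= x by rewrite mulr_ge0 // le_min ltW //=.
(* Rounding up loses nothing: both [n] and [#|S|] are integers at least [x], hence at least [m]. *)
have [m mE] : exists m : nat, Num.ceil x = m%:Z.
  have : 0 <= Num.ceil x by rewrite ceil_ge0 (lt_le_trans _ x0').
  by case: (Num.ceil x) => // m _; exists m.
have xm (l : nat) : x <= l%:R -> (m <= l)%N by rewrite -lez_nat -mE ceil_le_int.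
apply: le_trans (_ : m%:R <= _); first by have := ceil_ge x; rewrite mE.
rewrite ler_nat; apply: erdos_rogers_ge.
  apply: xm; apply: le_trans (_ : 1 * y <= _).
    by apply: ler_wpM2r => //; rewrite ge_min lexx orbT.
  rewrite mul1r -[leRHS]powRr1 ?ler0n // ler_powR //.
  apply: (@le_trans _ _ k.+1%:R^-1); first by rewrite gerBl ltW.
  by rewrite invf_le1 ?ltr0n // ler1n.
apply: (guarantees_free_induced_complete rk) => G Gn noK.
have [|S [_ freeS cardS]] := HC G [set: G]%SET _ noK; first by rewrite cardsT Gn.
exists S => //; apply: xm; apply: le_trans cardS.
by rewrite cardsT Gn; apply: ler_wpM2r => //; rewrite ge_min lexx.
Qed.
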